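(* There exists a finite (possibly empty) set $\Delta_2\subset\mathbb C$ such that for every $d^o\in\mathbb C\setminus(\Delta_2\cup\{0\})$, the polynomial $g(d^o,\bar x)$ defines $\mathcal O_{d^o}(\Sigma)$, i.e. the zero set of $g(d^o,\bar x)$ in $\mathbb C^3$ equals $\mathcal O_{d^o}(\Sigma)$.
   Context: Let $f\in\mathbb C[y_1,y_2,y_3]$ be irreducible, defining a surface $\Sigma$; $f_i=\partial f/\partial y_i$, $h_{\rm imp}=\sum f_i^2$, not identically zero on $\Sigma$. Consider the system in $(d,\bar x,\bar y,u)$: $f(\bar y)=0$; $f_i(\bar y)(x_j-y_j)-f_j(\bar y)(x_i-y_i)=0$ ($i<j$); $\sum_i(x_i-y_i)^2-d^2=0$; $u\,h_{\rm imp}(\bar y)-1=0$. The generic offset $\mathcal O_d(\Sigma)\subset\mathbb C^4$ is the Zariski closure of the projection of its solutions to $(d,\bar x)$; it is a hypersurface and $g(d,\bar x)$ denotes its square-free defining polynomial (generic offset polynomial). For $d^o\in\mathbb C\setminus\{0\}$, the offset $\mathcal O_{d^o}(\Sigma)\subset\mathbb C^3$ is the Zariski closure of the projection to $\bar x$ of the solutions $(\bar x,\bar y,u)$ of the same system with $d=d^o$. *)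

(* Defs.v *)
From HB Require Import structures.
From mathcomp Require Import all_boot all_order all_algebra.
Set Implicit Arguments. Unset Strict Implicit. Unset Printing Implicit Defensive.
Import GRing.Theory.
Local Open Scope ring_scope.

(* Polynomials in 3 variables y1,y2,y3 over K, realised as K[y3][y2][y1]:
   the outermost variable is y1, the innermost is y3. *)
Definition poly3 (K : closedFieldType) := {poly {poly {poly K}}}.
(* Polynomials in 4 variables (d, x1, x2, x3): K[x1,x2,x3][d]. *)
Definition poly4 (K : closedFieldType) := {poly poly3 K}.

Definition ev3 (K : closedFieldType) (p : poly3 K) (a1 a2 a3 : K) : K :=
  ((p.[a1%:P%:P]).[a2%:P]).[a3].
Definition spec4 (K : closedFieldType) (q : poly4 K) (d0 : K) : poly3 K :=
  q.[d0%:P%:P%:P].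
Definition ev4 (K : closedFieldType) (q : poly4 K) (d a1 a2 a3 : K) : K :=
  ev3 (spec4 q d) a1 a2 a3.

Definition pd1 (K : closedFieldType) (p : poly3 K) : poly3 K := deriv p.
Definition pd2 (K : closedFieldType) (p : poly3 K) : poly3 K :=
  map_poly (@deriv _) p.
Definition pd3 (K : closedFieldType) (p : poly3 K) : poly3 K :=
  map_poly (map_poly (@deriv _)) p.

Definition irreducible_elt (R : idomainType) (p : R) : Prop :=
  p != 0 /\ p \isn't a GRing.unit /\
  forall a b : R, p = a * b -> a \is a GRing.unit \/ b \is a GRing.unit.

Definition squarefree_elt (R : idomainType) (p : R) : Prop :=
  p != 0 /\ forall h q : R, p = h * h * q -> h \is a GRing.unit.

Definition h_imp (K : closedFieldType) (f : poly3 K) (y1 y2 y3 : K) : K :=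
  ev3 (pd1 f) y1 y2 y3 ^+ 2 + ev3 (pd2 f) y1 y2 y3 ^+ 2
  + ev3 (pd3 f) y1 y2 y3 ^+ 2.

Definition offset_system (K : closedFieldType) (f : poly3 K)
    (d x1 x2 x3 y1 y2 y3 u : K) : Prop :=
  let f1 := ev3 (pd1 f) y1 y2 y3 in
  let f2 := ev3 (pd2 f) y1 y2 y3 in
  let f3 := ev3 (pd3 f) y1 y2 y3 in
  ev3 f y1 y2 y3 = 0 /\
  f1 * (x2 - y2) - f2 * (x1 - y1) = 0 /\
  f1 * (x3 - y3) - f3 * (x1 - y1) = 0 /\
  f2 * (x3 - y3) - f3 * (x2 - y2) = 0 /\
  (x1 - y1) ^+ 2 + (x2 - y2) ^+ 2 + (x3 - y3) ^+ 2 - d ^+ 2 = 0 /\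
  u * h_imp f y1 y2 y3 - 1 = 0.

Definition zclosure3 (K : closedFieldType) (S : K -> K -> K -> Prop)
    (a1 a2 a3 : K) : Prop :=
  forall q : poly3 K, (forall b1 b2 b3, S b1 b2 b3 -> ev3 q b1 b2 b3 = 0) ->
    ev3 q a1 a2 a3 = 0.
Definition zclosure4 (K : closedFieldType) (S : K -> K -> K -> K -> Prop)
    (d a1 a2 a3 : K) : Prop :=
  forall q : poly4 K,
    (forall e b1 b2 b3, S e b1 b2 b3 -> ev4 q e b1 b2 b3 = 0) ->
    ev4 q d a1 a2 a3 = 0.

Definition generic_offset (K : closedFieldType) (f : poly3 K) :
    K -> K -> K -> K -> Prop :=
  zclosure4 (fun d x1 x2 x3 =>
    exists y1 y2 y3 u, offset_system f d x1 x2 x3 y1 y2 y3 u).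

Definition offset_at (K : closedFieldType) (f : poly3 K) (d0 : K) :
    K -> K -> K -> Prop :=
  zclosure3 (fun x1 x2 x3 =>
    exists y1 y2 y3 u, offset_system f d0 x1 x2 x3 y1 y2 y3 u).

Definition generic_offset_poly (K : closedFieldType) (f : poly3 K)
    (g : poly4 K) : Prop :=
  squarefree_elt (g : {poly poly3 K}) /\
  forall d x1 x2 x3, ev4 g d x1 x2 x3 = 0 <-> generic_offset f d x1 x2 x3.

(* Main.v *)
Require Import Defs.
From HB Require Import structures.
From mathcomp Require Import all_boot all_order all_algebra.
From mathcomp Require Import closed_field.
From Stdlib Require Import Classical.
Set Implicit Arguments. Unset Strict Implicit. Unset Printing Implicit Defensive.
Import GRing.Theory.
Local Open Scope ring_scope.

(** Let W be the set of all (d, x) reached by the offset system, so that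
    V(g) is the closure of W.  By quantifier elimination W is constructible; hence,
    for every prime factor p of g, some r prime to p is such that W either
    contains or avoids all of {p = 0, r <> 0}.  It cannot avoid it: otherwise
    r * (g / p) would vanish on W, hence on V(p), and p would divide it, whereas g is
    squarefree.  For all but finitely many d0 the specializations p(d0, x) and
    r(d0, x) are still without common factor, so a polynomial q vanishing on the
    fibre of W over d0 makes q * r(d0, x) vanish on V(p(d0, x)); each prime factor
    of p(d0, x) therefore divides q.  Prime factorizations (Gauss), the
    Nullstellensatz for primes and the generic coprimality of specializations are
    all obtained by adjoining one variable at a time. *)

(** * Prime factorizations and Gauss's lemma *)

Section Divisibility.
Variable R : idomainType.
Implicit Types (a b c p u : R) (s : seq R).

Definition divides a b := exists c, b = c * a.

Definition prime_elt p :=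
  [/\ p != 0, p \isn't a GRing.unit
    & forall a b, divides p (a * b) -> divides p a \/ divides p b].

Definition has_prime_factorizations :=
  forall a, a != 0 -> exists u s,
    [/\ u \is a GRing.unit, forall p, p \in s -> prime_elt p
      & a = u * \prod_(p <- s) p].

(** Lists rather than pairs: adding a variable turns two polynomials into the list of all their
    coefficients. *)
Definition no_common_factor s :=
  forall c, (forall a, a \in s -> divides c a) -> c \is a GRing.unit.

(** Membership in every ideal containing [s]. A Bezout relation is then used by choosing [I], for
    instance vanishing at a point or divisibility by a fixed element, with no cofactors to
    handle. *)
Definition in_ideal s a :=
  forall I : R -> Prop, I 0 -> (forall x y, I x -> I y -> I (x + y)) ->
    (forall x y, I x -> I (y * x)) -> (forall x, x \in s -> I x) -> I a.

Lemma dividesxx a : divides a a.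
Proof. by exists 1; rewrite mul1r. Qed.

Lemma divides0 a : divides a 0.
Proof. by exists 0; rewrite mul0r. Qed.

Lemma divides_mull a b c : divides a b -> divides a (c * b).
Proof. by case=> x ->; exists (c * x); rewrite mulrA. Qed.

Lemma divides_mulr a b c : divides a b -> divides a (b * c).
Proof. by rewrite mulrC; apply: divides_mull. Qed.

Lemma dividesD a b c : divides a b -> divides a c -> divides a (b + c).
Proof. by case=> x -> [y ->]; exists (x + y); rewrite mulrDl. Qed.

Lemma dividesB a b c : divides a b -> divides a c -> divides a (b - c).
Proof. by case=> x -> [y ->]; exists (x - y); rewrite mulrBl. Qed.

Lemma divides_trans b a c : divides a b -> divides b c -> divides a c.
Proof. by case=> x -> [y ->]; exists (y * x); rewrite mulrA. Qed.

Lemma divides_unit a u : u \is a GRing.unit -> divides a u -> a \is a GRing.unit.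
Proof. by move=> uu [x e]; move: uu; rewrite e unitrM => /andP[]. Qed.

Lemma divides_unitMl a b u :
  u \is a GRing.unit -> divides a (u * b) -> divides a b.
Proof. by move=> uu [x e]; exists (u^-1 * x); rewrite -mulrA -e mulKr. Qed.

Lemma prime_neq0 p : prime_elt p -> p != 0. Proof. by case. Qed.

Lemma prime_irreducible p a b : prime_elt p -> p = a * b ->
  a \is a GRing.unit \/ b \is a GRing.unit.
Proof.
case=> p0 _ pP e.
have [a0 b0] : a != 0 /\ b != 0.
  by apply/andP; rewrite -negb_or -mulf_eq0 -e.
case: (pP a b); first by rewrite -e; apply: dividesxx.
- case=> x ea; right; apply/unitrP; exists x.
  suff e1 : x * b = 1 by rewrite [b * x]mulrC e1.
  by apply: (mulfI a0); rewrite mulr1 [in RHS]ea e mulrCA.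
- case=> x eb; left; apply/unitrP; exists x.
  suff e1 : x * a = 1 by rewrite [a * x]mulrC e1.
  by apply: (mulIf b0); rewrite mul1r [in RHS]eb e mulrA.
Qed.

Lemma prime_divides_prod p s : prime_elt p -> divides p (\prod_(q <- s) q) ->
  exists2 q, q \in s & divides p q.
Proof.
case=> p0 pNu pP; elim: s => [|q s IHs].
  by rewrite big_nil => /(divides_unit (unitr1 _)) pu; rewrite pu in pNu.
rewrite big_cons => /pP[pq|/IHs[q' q's pq']].
  by exists q; rewrite ?mem_head.
by exists q'; rewrite // inE q's orbT.
Qed.

Lemma prime_no_common_factor p a :
  prime_elt p -> ~ divides p a -> no_common_factor [:: p; a].
Proof.
move=> pP pNa c cP; have [t e] := cP _ (mem_head _ _).
case: (prime_irreducible pP e) => // tu; case: pNa.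
apply: divides_trans (cP a _); last by rewrite !inE eqxx orbT.
by exists t^-1; rewrite e mulKr.
Qed.

Lemma nonunit_prime_divisor a : has_prime_factorizations -> a != 0 ->
  a \isn't a GRing.unit -> exists2 p, prime_elt p & divides p a.
Proof.
move=> fR a0 aNu; have [u [[|p s] [uu sP ea]]] := fR a a0.
  by rewrite ea big_nil mulr1 uu in aNu.
exists p; first by apply: sP; rewrite mem_head.
by rewrite ea big_cons; apply/divides_mull/divides_mulr/dividesxx.
Qed.

Lemma in_ideal_mem s a : a \in s -> in_ideal s a.
Proof. by move=> sa I _ _ _; apply. Qed.

Lemma in_ideal_catr s1 s2 a : in_ideal s2 a -> in_ideal (s1 ++ s2) a.
Proof.
move=> as2 I I0 ID IM Is; apply: as2 => // x xs.
by apply: Is; rewrite mem_cat xs orbT.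
Qed.

Lemma in_ideal_lin s a b x y :
  in_ideal s a -> in_ideal s b -> in_ideal s (x * a + y * b).
Proof.
move=> ai bi I I0 ID IM Is.
by apply: (ID); apply: (IM); [apply: (ai I) | apply: (bi I)].
Qed.

End Divisibility.

Lemma field_prime_factorizations (F : fieldType) : has_prime_factorizations F.
Proof.
by move=> a a0; exists a, [::]; rewrite unitfE big_nil mulr1; split.
Qed.

Section GaussLemma.
Variable R : idomainType.
Implicit Types (c : R) (p q t : {poly R}).

Lemma divides_polyCP c p : divides c%:P p <-> forall i, divides c p`_i.
Proof.
split=> [[q ->] i|]; first by exists q`_i; rewrite coefMC.
elim/poly_ind: p => [_|p a IHp cP]; first exact: divides0.
have [|q ->] := IHp.
  by move=> i; have := cP i.+1; rewrite coefD coefMX coefC /= addr0.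
have := cP 0; rewrite coefD coefMX coefC /= add0r => -[b ->].
by exists (q * 'X + b%:P); rewrite mulrDl polyCM mulrAC.
Qed.

Lemma divides_polyC c d : divides c%:P d%:P -> divides c d.
Proof. by move/divides_polyCP/(_ 0); rewrite coefC. Qed.

Lemma divides_polyC_MX c p : divides c%:P (p * 'X) -> divides c%:P p.
Proof.
move/divides_polyCP=> cP; apply/divides_polyCP => i.
by have := cP i.+1; rewrite coefMX.
Qed.

(** Double induction on the two factors. [c] divides the product of the constant terms, hence one of
    them; removing that term and cancelling ['X] leaves a shorter factor. *)
Lemma prime_polyC c : prime_elt c -> prime_elt c%:P.
Proof.
case=> c0 cNu cP; split; rewrite ?polyC_eq0 //.
  by rewrite poly_unitE coefC /= (negPf cNu) andbF.
elim/poly_ind => [b _|a a0 IHa]; first by left; apply: divides0.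
elim/poly_ind => [_|b b0 IHb]; first by right; apply: divides0.
set A := a * 'X + _; set B := b * 'X + _ => cAB.
have : divides c (a0 * b0).
  move/divides_polyCP: (cAB) => /(_ 0).
  by rewrite coef0M !coefD !coefMX !coefC /= !add0r.
have polyC_div x : divides c x -> divides c%:P x%:P.
  by case=> y ->; exists y%:P; rewrite polyCM.
case/cP => /polyC_div cx.
- case: (IHa B) => [|ca|]; last by right.
    apply: divides_polyC_MX; rewrite mulrAC.
    have -> : a * 'X * B = A * B - a0%:P * B by rewrite /A mulrDl addrK.
    by apply: dividesB => //; apply: divides_mulr.
  by left; apply: dividesD => //; apply: divides_mulr.
- case: IHb => [|cA|cb]; [|by left|].
    apply: divides_polyC_MX; rewrite -mulrA.
    have -> : A * (b * 'X) = A * B - A * b0%:P by rewrite /B mulrDr addrK.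
    by apply: dividesB => //; apply: divides_mull.
  by right; apply: dividesD => //; apply: divides_mulr.
Qed.

Definition primitive_poly p := forall c, divides c%:P p -> c \is a GRing.unit.

Hypothesis fR : has_prime_factorizations R.

(** Primes dividing all coefficients are stripped one at a time. Each uses up a prime factor of the
    leading coefficient, so the length of a factorization of that coefficient bounds the process. *)
Lemma primitive_part p : p != 0 ->
  exists c q, [/\ c != 0, primitive_poly q & p = c%:P * q].
Proof.
move=> p0; have l0 : lead_coef p != 0 by rewrite lead_coef_eq0.
have [u [s [uu sP el]]] := fR l0.
have [n] := ubnP (size s); elim: n => // n IHn in p p0 l0 u s uu sP el *.
rewrite ltnS => les.
case: (classic (primitive_poly p)) => [pp|pNp].
  by exists 1, p; rewrite oner_eq0 mul1r.
have [c cP] := not_all_ex_not _ _ pNp.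
have [cp /negP cNu] := imply_to_and _ _ cP.
have c0 : c != 0.
  by apply: contraNneq p0 => c0; case: cp => q ->; rewrite c0 mulr0.
have [w wP wc] := nonunit_prime_divisor fR c0 cNu.
have [q ep] : divides w%:P p.
  by apply: divides_trans cp; case: wc => x ->; exists x%:P; rewrite polyCM.
have w0 := prime_neq0 wP.
have q0 : q != 0 by apply: contraNneq p0 => q0; rewrite ep q0 mul0r.
have lq : lead_coef p = w * lead_coef q.
  by rewrite ep lead_coefM lead_coefC mulrC.
have : divides w (\prod_(r <- s) r).
  by apply: (divides_unitMl uu); rewrite -el lq; apply/divides_mulr/dividesxx.
case/(prime_divides_prod wP) => r rs [v er].
have vu : v \is a GRing.unit.
  by case: (prime_irreducible (sP r rs) er) => // wu; case: wP; rewrite wu.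
(* As [r = v * w] with [v] a unit, dividing the leading coefficient by [w] removes [r] from the list
   and moves [v] into the unit. *)
case: (IHn q q0 _ (u * v) (rem r s)); rewrite ?lead_coef_eq0 ?unitrM ?uu //.
- by move=> x /mem_rem /sP.
- apply: (mulfI w0); rewrite -lq el (big_rem r) //= [X in u * (X * _)]er.
  by rewrite !mulrA [w * u]mulrC -[u * w * v]mulrA [w * v]mulrC mulrA.
- have s_gt0 : (0 < size s)%N by case: (s) rs.
  by rewrite size_rem // prednK.
move=> d [q' [d0 q'P eq]]; exists (w * d), q'; split => //.
  by rewrite mulf_neq0.
by rewrite ep eq polyCM mulrC mulrA.
Qed.

(** The primes of [c] are cancelled one by one: each stays prime in [{poly R}] and cannot divide the
    primitive [p], so it divides the cofactor. *)
Lemma primitive_divides_polyCM p q c : primitive_poly p -> c != 0 ->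
  divides p (c%:P * q) -> divides p q.
Proof.
move=> pp c0; have [u [s [uu sP ->]]] := fR c0.
rewrite polyCM -mulrA => /divides_unitMl pd.
have {pd} : divides p ((\prod_(x <- s) x)%:P * q).
  by apply: pd; rewrite rmorph_unit.
elim: s sP => [_|w s IHs sP]; first by rewrite big_nil mul1r.
have wP : prime_elt w by apply: sP; rewrite mem_head.
rewrite big_cons polyCM -mulrA => -[t e].
have [w0 _ wPM] := prime_polyC wP.
case: (wPM t p); first by rewrite -e; apply/divides_mulr/dividesxx.
- case=> t' et; apply: IHs => [x xs|]; first by apply: sP; rewrite inE xs orbT.
  by exists t'; apply: (mulfI w0); rewrite e et mulrA [w%:P * t']mulrC.
- by move/pp=> wu; case: wP; rewrite wu.
Qed.

(** Over a domain [%|] allows a nonzero scalar in front of the dividend, so it is divisibility over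
    the fraction field. This is the passage back to [R]. *)
Lemma primitive_dvdp p q : primitive_poly p -> (p %| q) -> divides p q.
Proof.
move=> pp /Pdiv.Idomain.dvdpP[[c t] /= c0 e].
by apply: (primitive_divides_polyCM pp c0); exists t; rewrite mul_polyC.
Qed.

Lemma divides_dvdp p q : divides p q -> p %| q.
Proof. by case=> t ->; apply/dvdp_mull/dvdpp. Qed.

Lemma primitive_irreducible_prime p :
  primitive_poly p -> irreducible_poly p -> prime_elt p.
Proof.
move=> pp ip; split; first exact: irredp_neq0.
  by rewrite poly_unitE gtn_eqF //; case: ip.
move=> a b /divides_dvdp pab.
case: (boolP (p %| a)) => [/(primitive_dvdp pp)|pNa]; [by left | right].
apply: primitive_dvdp => //; rewrite -(Gauss_dvdpr _ (_ : coprimep p a)) //.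
rewrite /coprimep; apply: contraNT pNa => sg.
have := ip.2 _ sg (dvdp_gcdl _ _) => /eqp_dvdl <-; exact: dvdp_gcdr.
Qed.

Lemma primitive_divisor p q : primitive_poly p -> divides q p ->
  primitive_poly q.
Proof. by move=> pp qp c cq; apply/pp/(divides_trans cq). Qed.

(** Induction on the degree. A proper factor over the fraction field is replaced by its primitive
    part, which is a true factor; its cofactor is again primitive, and both have smaller degree. *)
Lemma primitive_prime_factorization p : p != 0 -> primitive_poly p ->
  exists u s, [/\ u \is a GRing.unit, forall q, q \in s -> prime_elt q
      & p = u * \prod_(q <- s) q].
Proof.
have [n] := ubnP (size p); elim: n => // n IHn in p *.
rewrite ltnS => lep p0 pp.
have [sp|sp] := leqP (size p) 1.
  exists p, [::]; rewrite big_nil mulr1; split => //.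
  rewrite [p]size1_polyC //; apply/rmorph_unit/pp.
  by rewrite -size1_polyC //; apply: dividesxx.
case: (classic (irreducible_poly p)) => [ip|pNi].
  exists 1, [:: p]; rewrite unitr1 mul1r big_seq1; split => // q.
  by rewrite inE => /eqP->; apply: primitive_irreducible_prime.
have [q [sq qp qNp]] : exists q, [/\ size q != 1, q %| p & ~~ (q %= p)].
  apply: NNPP => nq; case: pNi; split=> // q sq qp.
  by apply: contra_notT nq => qNp; exists q.
have q0 : q != 0 by apply: contraTneq qp => ->; rewrite dvd0p.
have [c [r [c0 rP eq]]] := primitive_part q0.
have qr : q %= r by rewrite eq mul_polyC eqp_scale.
rewrite (eqp_dvdl _ qr) in qp; rewrite (eqp_ltrans qr) in qNp.
rewrite (eqp_size qr) in sq.
have [t ep] := primitive_dvdp rP qp.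
have [t0 r0] : t != 0 /\ r != 0.
  by apply/andP; rewrite -negb_or -mulf_eq0 -ep.
have tP : primitive_poly t.
  by apply: primitive_divisor pp _; rewrite ep; apply/divides_mulr/dividesxx.
have ltr : (size r < size p)%N.
  rewrite ltn_neqAle dvdp_size_eqp // qNp /=; exact: dvdp_leq.
have ltt : (size t < size p)%N.
  rewrite ep size_mul //; case: (size r) sq (size_poly_gt0 r) => [|[|k]] //.
    by rewrite r0.
  by move=> _ _; rewrite !addnS /= ltnS leq_addr.
have [u1 [s1 [u1u s1P et]]] := IHn t (leq_trans ltt lep) t0 tP.
have [u2 [s2 [u2u s2P er]]] := IHn r (leq_trans ltr lep) r0 rP.
exists (u1 * u2), (s1 ++ s2); split; first by rewrite unitrM u1u.
  by move=> x; rewrite mem_cat => /orP[/s1P|/s2P].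
by rewrite ep et er big_cat /= mulrACA.
Qed.

Theorem poly_prime_factorizations : has_prime_factorizations {poly R}.
Proof.
move=> p p0; have [c [q [c0 qP ep]]] := primitive_part p0.
have q0 : q != 0 by apply: contraNneq p0 => q0; rewrite ep q0 mulr0.
have [u1 [s1 [u1u s1P ec]]] := fR c0.
have [u2 [s2 [u2u s2P eq]]] := primitive_prime_factorization q0 qP.
exists (u1%:P * u2), ([seq x%:P | x <- s1] ++ s2); split.
- by rewrite unitrM u2u rmorph_unit.
- by move=> x; rewrite mem_cat => /orP[/mapP[y /s1P /prime_polyC yP ->]|/s2P].
- by rewrite ep ec eq big_cat big_map /= polyCM rmorph_prod mulrACA.
Qed.

(** Iterated [egcdp] computes a gcd over the fraction field as a combination with coefficients still
    in [{poly R}]. *)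
Lemma ideal_gcdp (s : seq {poly R}) :
  exists2 d, in_ideal s d & forall p, p \in s -> d %| p.
Proof.
elim: s => [|p s [d ds dP]]; first by exists 0 => // I.
exists ((egcdp p d).1 * p + (egcdp p d).2 * d).
  apply: in_ideal_lin; first by apply: in_ideal_mem; rewrite mem_head.
  exact: (@in_ideal_catr _ [:: p]).
move=> q; rewrite inE -(eqp_dvdl _ (egcdpE p d)) => /predU1P[->|/dP].
  exact: dvdp_gcdl.
by apply: dvdp_trans; apply: dvdp_gcdr.
Qed.

(* Coprime polynomials over R are coprime over the fraction field, whence a
   Bezout relation whose right-hand side is a nonzero constant. *)
Lemma no_common_factor_ideal (s : seq {poly R}) : no_common_factor s ->
  exists2 c, c != 0 & in_ideal s c%:P.
Proof.
move=> cs; have [d ds dP] := ideal_gcdp s.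
have [d0|d0] := eqVneq d 0.
  have : ('X : {poly R}) \is a GRing.unit.
    apply: cs => p /dP; rewrite d0 dvd0p => /eqP ->; exact: divides0.
  by rewrite poly_unitE size_polyX.
have [c [q [c0 qP ed]]] := primitive_part d0.
have : q \is a GRing.unit.
  apply: cs => p /dP dp; apply: primitive_dvdp => //.
  by apply: dvdp_trans dp; rewrite ed mul_polyC dvdpZr.
rewrite poly_unitE => /andP[/eqP sq _].
have eq := size1_polyC (eq_leq sq).
exists (c * q`_0); last by rewrite polyCM -eq -ed.
by rewrite mulf_neq0 // -polyC_eq0 -eq -size_poly_eq0 sq.
Qed.

End GaussLemma.
(** * Affine spaces: points, Nullstellensatz for primes, specialization *)

Section AffineSpace.
Variable K : closedFieldType.

(** The polynomial functions on an affine space together with its points, kept abstract so that the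
    number of variables can grow by induction. *)
Record coord_ring := CoordRing {
  cr_ring :> idomainType;
  cr_const : {rmorphism K -> cr_ring};
  cr_point : Type;
  cr_eval : cr_point -> {rmorphism cr_ring -> K} }.

(** The properties carried together through the induction. In [cr_generic_coprime] the variable of
    [{poly A}] is the parameter to be specialized. *)
Record affine_theory (A : coord_ring) : Prop := {
  cr_factor : has_prime_factorizations A;
  cr_constK : forall (i : cr_point A) x, cr_eval i (cr_const A x) = x;
  cr_separated : forall a : A, a != 0 -> exists i : cr_point A, cr_eval i a != 0;
  cr_nullstellensatz : forall p q : A, prime_elt p ->
    (forall i : cr_point A, cr_eval i p = 0 -> cr_eval i q = 0) -> divides p q;
  cr_generic_coprime : forall s : seq {poly A}, no_common_factor s ->
    exists Delta : seq K, forall d, d \notin Delta ->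
      no_common_factor [seq p.[cr_const A d] | p <- s] }.

Definition affine_point : coord_ring :=
  @CoordRing K idfun unit (fun=> idfun).

(** The new variable is outermost and is substituted first, so that [ev3] and [ev4] are evaluations
    in this sense by computation. *)
Definition affine_line (A : coord_ring) : coord_ring :=
  @CoordRing {poly A} (polyC \o cr_const A) (cr_point A * K)
    (fun ix => cr_eval ix.1 \o horner_eval (cr_const A ix.2)).

Lemma poly_finite_roots (p : {poly K}) : p != 0 ->
  exists s : seq K, forall x, x \notin s -> p.[x] != 0.
Proof.
move=> p0; have [s ep] := closed_field_poly_normal p; exists s => x xs.
by rewrite ep hornerZ mulf_neq0 ?lead_coef_eq0 // -rootE root_prod_XsubC.
Qed.

Lemma no_common_factor_nonzero (R : idomainType) (s : seq {poly R}) :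
  no_common_factor s -> exists2 p, p \in s & p != 0.
Proof.
move=> cs; apply: NNPP => ns.
(* If all entries were 0, the nonunit ['X] would be a common factor. *)
have : ('X : {poly R}) \is a GRing.unit.
  apply: cs => p ps; have [->|p0] := eqVneq p 0; first exact: divides0.
  by case: ns; exists p.
by rewrite poly_unitE size_polyX.
Qed.

(** A field has no primes, which makes the Nullstellensatz vacuous, and a list over it is coprime as
    soon as one entry is nonzero. *)
Lemma affine_point_theory : affine_theory affine_point.
Proof.
split; first exact: field_prime_factorizations.
- by [].
- by move=> a a0; exists tt.
- by move=> p q [p0]; rewrite unitfE p0.
move=> s /no_common_factor_nonzero[p ps p0].
have [Delta DP] := poly_finite_roots p0; exists Delta => d /DP pd c cP.
apply: (@divides_unit _ _ p.[d]); first by rewrite unitfE.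
by apply: cP; apply/mapP; exists p.
Qed.

Section Step.
Variables (A : coord_ring) (tA : affine_theory A).

Lemma eval_horner (i : cr_point A) (p : {poly A}) x :
  cr_eval i p.[cr_const A x] = (map_poly (cr_eval i) p).[x].
Proof. by rewrite -[in RHS](cr_constK tA i x) horner_map. Qed.

Lemma specialization_nonzero (p : {poly A}) : p != 0 ->
  exists s : seq K, forall d, d \notin s -> p.[cr_const A d] != 0.
Proof.
move=> p0; have [|i ip] := cr_separated tA (a := lead_coef p).
  by rewrite lead_coef_eq0.
have [|s sP] := poly_finite_roots (p := map_poly (cr_eval i) p).
  by rewrite -lead_coef_eq0 lead_coef_map_eq.
exists s => d /sP; rewrite -eval_horner; apply: contraNneq => ->.
by rewrite rmorph0.
Qed.

Lemma line_separated (p : {poly A}) : p != 0 ->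
  exists ix : cr_point (affine_line A), cr_eval ix (p : affine_line A) != 0.
Proof.
move=> p0; have [|i ip] := cr_separated tA (a := lead_coef p).
  by rewrite lead_coef_eq0.
have /closed_nonrootP[x px] : map_poly (cr_eval i) p != 0.
  by rewrite -lead_coef_eq0 lead_coef_map_eq.
by exists (i, x); rewrite /= /horner_eval eval_horner.
Qed.

(** If [p] is constant in the new variable, the statement over [A] applies to each coefficient of
    [q]. Otherwise, if [p] did not divide [q], the two would generate a nonzero constant [c],
    contradicted by a common zero over a point where [c] does not vanish. *)
Lemma line_nullstellensatz (p q : {poly A}) : prime_elt p ->
  (forall ix : cr_point (affine_line A),
    cr_eval ix (p : affine_line A) = 0 -> cr_eval ix (q : affine_line A) = 0) ->
  divides p q.
Proof.
move=> pP Hpq; have fA := cr_factor tA; have [p0 pNu _] := pP.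
have {}Hpq i x : (map_poly (cr_eval i) p).[x] = 0 ->
    (map_poly (cr_eval i) q).[x] = 0.
  by rewrite -!eval_horner; apply: (Hpq (i, x)).
have [sp|sp] := leqP (size p) 1.
  have ep := size1_polyC sp; set c := p`_0 in ep.
  have cP : prime_elt c.
    split; first by rewrite -polyC_eq0 -ep.
      by apply: contraNN pNu => cu; rewrite ep rmorph_unit.
    move=> a b [t e]; case: pP => _ _ /(_ a%:P b%:P).
    rewrite ep -polyCM e => -[|/divides_polyC|/divides_polyC]; [|by left|by right].
    by rewrite polyCM; apply/divides_mull/dividesxx.
  rewrite ep; apply/divides_polyCP => j; apply: (cr_nullstellensatz tA cP) => i ic.
  (* Over a zero of [c] the whole line lies in [p = 0], so [q] has every scalar as a root there. *)
  have : map_poly (cr_eval i) q == 0.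
    apply/negPn/negP => /closed_nonrootP[x /negP[]]; apply/rootP/Hpq.
    by rewrite ep map_polyC hornerC.
  by move/eqP/polyP/(_ j); rewrite coef_map coef0.
apply: NNPP => pNq.
have [c c0 ci] := no_common_factor_ideal fA (prime_no_common_factor pP pNq).
(* A nonvanishing leading coefficient keeps the degree of [p] positive on the fibre, which therefore
   contains a root. *)
have [|i] := cr_separated tA (a := c * lead_coef p).
  by rewrite mulf_neq0 // lead_coef_eq0.
rewrite rmorphM mulf_eq0 negb_or => /andP[ic ip].
have /closed_rootP[x /rootP px] : size (map_poly (cr_eval i) p) != 1.
  by rewrite size_poly_eq // gtn_eqF.
case/eqP: ic.
suff : (map_poly (cr_eval i) c%:P).[x] = 0 by rewrite map_polyC hornerC.
apply: (ci (fun r => (map_poly (cr_eval i) r).[x] = 0)).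
- by rewrite rmorph0 horner0.
- by move=> a b ea eb; rewrite rmorphD hornerD ea eb addr0.
- by move=> a b ea; rewrite rmorphM hornerM ea mulr0.
- by move=> r; rewrite !inE => /orP[] /eqP-> //; apply: Hpq.
Qed.

Lemma no_common_factor_swapXY (s : seq {poly {poly A}}) :
  no_common_factor s -> no_common_factor [seq swapXY p | p <- s].
Proof.
move=> cs c cP; rewrite -[c]swapXYK; apply/rmorph_unit/cs => p ps.
have [|t e] := cP (swapXY p); first by apply/mapP; exists p.
by exists (swapXY t); rewrite -[LHS]swapXYK e rmorphM.
Qed.

Lemma no_common_factor_coefs (R : idomainType) (s : seq {poly R}) :
  no_common_factor s ->
  no_common_factor (flatten [seq polyseq p | p <- s]).
Proof.
move=> cs c cP; have : c%:P \is a GRing.unit.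
  apply: cs => p ps; apply/divides_polyCP => i.
  have [lt|ge] := ltnP i (size p); last by rewrite nth_default //; apply: divides0.
  by apply: cP; apply/flatten_mapP; exists p => //; apply: mem_nth.
by rewrite poly_unitE coefC => /andP[].
Qed.

(* With the parameter moved innermost, a common factor of the specializations
   divides the specialization of the Bezout constant, so it is itself constant in
   the new variable and divides all coefficients. *)
Lemma line_generic_coprime (s : seq {poly {poly A}}) : no_common_factor s ->
  exists Delta : seq K, forall d, d \notin Delta ->
    no_common_factor [seq p.[(cr_const A d)%:P] | p <- s].
Proof.
move=> /no_common_factor_swapXY; set s' := map _ s => cs.
have fX := poly_prime_factorizations (cr_factor tA).
have [c c0 ci] := no_common_factor_ideal fX cs.
have [D1 D1P] := specialization_nonzero c0.
have [D2 D2P] := cr_generic_coprime tA (no_common_factor_coefs cs).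
exists (D1 ++ D2) => d; rewrite mem_cat negb_or => /andP[/D1P cd /D2P {D2P}cs2].
set e := cr_const A d in cd cs2 *; pose phi := horner_eval e.
have phiE p : p.[e%:P] = map_poly phi (swapXY p).
  by rewrite -[in LHS](swapXYK p) horner_swapXY.
move=> r rP.
have rs p : p \in s' -> divides r (map_poly phi p).
  case/mapP=> q qs ->; rewrite -phiE; apply: rP.
  by apply/mapP; exists q.
have : divides r (map_poly phi c%:P).
  apply: (ci (fun x => divides r (map_poly phi x))) => //.
  - by rewrite rmorph0; apply: divides0.
  - by move=> x y rx ry; rewrite rmorphD; apply: dividesD.
  - by move=> x y rx; rewrite rmorphM; apply: divides_mull.
rewrite map_polyC /= => -[t et].
have ct0 : phi c != 0 by [].
have [t0 r0] : t != 0 /\ r != 0.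
  by apply/andP; rewrite -negb_or -mulf_eq0 -et polyC_eq0.
have sr : (size r <= 1)%N.
  have := size_polyC (phi c); rewrite et size_mul // ct0 /=.
  have := size_poly_gt0 t; rewrite t0.
  by case: (size t) => // n _ /= <-; apply: leq_addl.
have er := size1_polyC sr; rewrite er; apply/rmorph_unit/cs2 => a.
case/mapP=> b /flatten_mapP[p ps /(nthP 0)[j _ <-]] ->.
have := rs p ps; rewrite [X in divides X _]er => /divides_polyCP/(_ j).
by rewrite coef_map.
Qed.

Lemma affine_line_theory : affine_theory (affine_line A).
Proof.
split.
- exact/poly_prime_factorizations/cr_factor.
- by move=> i x /=; rewrite /horner_eval hornerC cr_constK.
- exact: line_separated.
- exact: line_nullstellensatz.
- exact: line_generic_coprime.
Qed.

End Step.

Definition affine_space n := iter n affine_line affine_point.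

Lemma affine_space_theory n : affine_theory (affine_space n).
Proof.
by elim: n => [|n IHn]; [apply: affine_point_theory | apply: affine_line_theory].
Qed.

End AffineSpace.
(** * The offset system as a constructible set *)

Section Constructible.
Variable K : closedFieldType.

Definition poly_term (R : nzRingType) (tr : R -> GRing.term K) i (p : {poly R}) :=
  foldr (fun c t => t * 'X_i + tr c)%T 0%T p.

Lemma rterm_poly_term (R : nzRingType) (tr : R -> GRing.term K) i p :
  (forall c, GRing.rterm (tr c)) -> GRing.rterm (poly_term tr i p).
Proof.
move=> rtr; rewrite /poly_term; case: p => s /= _.
by elim: s => //= c s ->; rewrite rtr.
Qed.

Lemma eval_poly_term (R : nzRingType) (ev : {rmorphism R -> K}) tr e i x p :
  (forall c, GRing.eval e (tr c) = ev c) -> ev x = e`_i ->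
  GRing.eval e (poly_term tr i p) = ev p.[x].
Proof.
move=> trE xE; rewrite /poly_term /horner; case: p => s /= _.
elim: s => /= [|c s ->]; first by rewrite mulr0n rmorph0.
by rewrite trE -xE rmorphD rmorphM.
Qed.

Definition term3 i1 i2 i3 (p : poly3 K) : GRing.term K :=
  poly_term (poly_term (poly_term GRing.Const i3) i2) i1 p.

Lemma rterm_term3 i1 i2 i3 p : GRing.rterm (term3 i1 i2 i3 p).
Proof.
apply: rterm_poly_term => p1; apply: rterm_poly_term => p2.
exact: rterm_poly_term.
Qed.

Lemma eval_term3 e i1 i2 i3 p :
  GRing.eval e (term3 i1 i2 i3 p) = ev3 p e`_i1 e`_i2 e`_i3.
Proof.
(* Evaluation in the inner variables is exhibited as a ring morphism applied to a Horner value in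
   the outer one, the shape [eval_poly_term] expects. *)
rewrite /ev3 -[RHS]/((horner_eval e`_i3 \o horner_eval (e`_i2)%:P) _).
apply: eval_poly_term => [q|]; last by rewrite /= /horner_eval !hornerC.
rewrite -[RHS]/(horner_eval e`_i3 _).
apply: eval_poly_term => [r|]; last by rewrite /= /horner_eval hornerC.
exact: (@eval_poly_term _ idfun).
Qed.

(* Variables 0-3 are d, x1, x2, x3; variables 4-7 are y1, y2, y3, u. *)
Definition offset_formula (f : poly3 K) : GRing.formula K :=
  let t := term3 4 5 6 in
  let f1 := t (pd1 f) in let f2 := t (pd2 f) in let f3 := t (pd3 f) in
  ('exists 'X_4, 'exists 'X_5, 'exists 'X_6, 'exists 'X_7,
    t f == 0 /\
    f1 * ('X_2 - 'X_5) - f2 * ('X_1 - 'X_4) == 0 /\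
    f1 * ('X_3 - 'X_6) - f3 * ('X_1 - 'X_4) == 0 /\
    f2 * ('X_3 - 'X_6) - f3 * ('X_2 - 'X_5) == 0 /\
    ('X_1 - 'X_4) ^+ 2 + ('X_2 - 'X_5) ^+ 2 + ('X_3 - 'X_6) ^+ 2
      - 'X_0 ^+ 2 == 0 /\
    'X_7 * (f1 ^+ 2 + f2 ^+ 2 + f3 ^+ 2) - 1 == 0)%T.

Lemma rformula_offset f : GRing.rformula (offset_formula f).
Proof. by rewrite /= !rterm_term3. Qed.

Lemma holds_offset f d x1 x2 x3 :
  GRing.holds [:: d; x1; x2; x3] (offset_formula f) <->
  exists y1 y2 y3 u, offset_system f d x1 x2 x3 y1 y2 y3 u.
Proof.
split=> [] [y1 [y2 [y3 [u]]]] H; exists y1, y2, y3, u; move: H;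
by rewrite /= !eval_term3 /offset_system /h_imp /=.
Qed.

Theorem offset_projection_constructible f : exists phi : GRing.formula K,
  [/\ GRing.qf_form phi, GRing.rformula phi
    & forall d x1 x2 x3, GRing.qf_eval [:: d; x1; x2; x3] phi <->
        exists y1 y2 y3 u, offset_system f d x1 x2 x3 y1 y2 y3 u].
Proof.
have wf := @ClosedFieldQE.wf_ex_elim K.
have ok := ClosedFieldQE.holds_ex_elim (@solve_monicpoly K).
exists (GRing.quantifier_elim (@ClosedFieldQE.ex_elim K) (offset_formula f)).
have /andP[qf rf] := GRing.quantifier_elim_wf wf (rformula_offset f).
split=> // d x1 x2 x3; rewrite -holds_offset.
have := GRing.quantifier_elim_rformP wf ok [:: d; x1; x2; x3] (rformula_offset f).
by move/rwP => [H1 H2]; split.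
Qed.

End Constructible.

(** * Truth of formulas at the generic point of a hypersurface *)

Section GenericTruth.
Variables (K : closedFieldType) (A : coord_ring K) (tA : affine_theory A).
Variable env : cr_point A -> seq K.
Hypothesis env_regular :
  forall i, exists a : A, forall x, (env x)`_i = cr_eval x a.

(** Terms without inverses are polynomial in the coordinates. *)
Lemma rterm_regular t : GRing.rterm t ->
  exists a : A, forall x, GRing.eval (env x) t = cr_eval x a.
Proof.
elim: t => //=.
- by move=> c _; exists (cr_const A c) => x; rewrite (cr_constK tA).
- by move=> n _; exists n%:R => x; rewrite rmorph_nat.
- move=> t1 IH1 t2 IH2 /andP[/IH1[a1 E1] /IH2[a2 E2]].
  by exists (a1 + a2) => x; rewrite E1 E2 rmorphD.
- by move=> t IH /IH[a E]; exists (- a) => x; rewrite E rmorphN.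
- by move=> t IH n /IH[a E]; exists (a *+ n) => x; rewrite E rmorphMn.
- move=> t1 IH1 t2 IH2 /andP[/IH1[a1 E1] /IH2[a2 E2]].
  by exists (a1 * a2) => x; rewrite E1 E2 rmorphM.
- by move=> t IH n /IH[a E]; exists (a ^+ n) => x; rewrite E rmorphXn.
Qed.

(* A quantifier-free formula has a truth value at the generic point of the
   hypersurface [p = 0], which it keeps on a dense open subset. *)
Lemma generic_truth_value (p : A) (phi : GRing.formula K) : prime_elt p ->
  GRing.qf_form phi -> GRing.rformula phi ->
  exists (r : A) (b : bool), ~ divides p r /\
    forall x, cr_eval x p = 0 -> cr_eval x r != 0 ->
      GRing.qf_eval (env x) phi = b.
Proof.
move=> [_ pNu pM].
have p1 : ~ divides p 1.
  by move/(divides_unit (unitr1 _)) => pu; rewrite pu in pNu.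
(* Two such open sets meet [p = 0] in a common one: by primality [p] does not divide [r1 * r2]. *)
have binary op (phi1 phi2 phi12 : GRing.formula K) :
    (forall e, GRing.qf_eval e phi12 =
       op (GRing.qf_eval e phi1) (GRing.qf_eval e phi2)) ->
    (exists r b, ~ divides p r /\ forall x, cr_eval x p = 0 ->
      cr_eval x r != 0 -> GRing.qf_eval (env x) phi1 = b) ->
    (exists r b, ~ divides p r /\ forall x, cr_eval x p = 0 ->
      cr_eval x r != 0 -> GRing.qf_eval (env x) phi2 = b) ->
    exists r b, ~ divides p r /\ forall x, cr_eval x p = 0 ->
      cr_eval x r != 0 -> GRing.qf_eval (env x) phi12 = b.
  move=> opE [r1 [b1 [pr1 H1]]] [r2 [b2 [pr2 H2]]].
  exists (r1 * r2), (op b1 b2); split=> [/pM[]|x px] //.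
  rewrite rmorphM mulf_eq0 negb_or => /andP[rx1 rx2].
  by rewrite opE H1 ?H2.
elim: phi => //=.
- by move=> b _ _; exists 1, b.
- move=> t1 t2 _ /andP[/rterm_regular[a1 E1] /rterm_regular[a2 E2]].
  (* An equation holds on all of [p = 0] if [p] divides the difference of its sides; otherwise it
     fails wherever that difference is nonzero. *)
  case: (classic (divides p (a1 - a2))) => [[c ec]|pNd].
    exists 1, true; split=> // x px _; rewrite E1 E2 -subr_eq0 -rmorphB ec.
    by rewrite rmorphM px mulr0 eqxx.
  exists (a1 - a2), false; split=> // x _.
  by rewrite E1 E2 rmorphB subr_eq0 => /negPf.
- move=> f1 IH1 f2 IH2 /andP[/IH1 {}IH1 /IH2 {}IH2] /andP[/IH1 {}IH1 /IH2 {}IH2].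
  exact: (binary andb f1 f2 (GRing.And f1 f2)) IH1 IH2.
- move=> f1 IH1 f2 IH2 /andP[/IH1 {}IH1 /IH2 {}IH2] /andP[/IH1 {}IH1 /IH2 {}IH2].
  exact: (binary orb f1 f2 (GRing.Or f1 f2)) IH1 IH2.
- move=> f1 IH1 f2 IH2 /andP[/IH1 {}IH1 /IH2 {}IH2] /andP[/IH1 {}IH1 /IH2 {}IH2].
  exact: (binary implb f1 f2 (GRing.Implies f1 f2)) IH1 IH2.
- move=> f1 IH1 /IH1 {}IH1 /IH1[r [b [pr H]]]; exists r, (~~ b); split=> // x px rx.
  by rewrite H.
Qed.

End GenericTruth.

(** * Prime factors of the generic offset polynomial and their specializations *)

Section Offset.
Variable K : closedFieldType.
Implicit Types (p q r : {poly {poly {poly {poly K}}}}).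

Definition env4 (x : cr_point (affine_space K 4)) : seq K :=
  [:: x.2; x.1.2; x.1.1.2; x.1.1.1.2].

Lemma env4_regular i : exists a : affine_space K 4,
  forall x, (env4 x)`_i = cr_eval x a.
Proof.
case: i => [|[|[|[|i]]]].
- by exists 'X => x /=; rewrite /horner_eval hornerX !hornerC.
- by exists 'X%:P => x /=; rewrite /horner_eval hornerC hornerX !hornerC.
- by exists 'X%:P%:P => x /=; rewrite /horner_eval !hornerC hornerX hornerC.
- by exists 'X%:P%:P%:P => x /=; rewrite /horner_eval !hornerC hornerX.
- by exists 0 => x; rewrite nth_default // rmorph0.
Qed.

Lemma ev4_eval p d a1 a2 a3 :
  ev4 p d a1 a2 a3 = @cr_eval K (affine_space K 4) (tt, a3, a2, a1, d) p.
Proof. by []. Qed.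

Lemma ev3_eval (p : poly3 K) a1 a2 a3 :
  ev3 p a1 a2 a3 = @cr_eval K (affine_space K 3) (tt, a3, a2, a1) p.
Proof. by []. Qed.

Lemma prime_factor_generically_projected f g p m :
  (forall d x1 x2 x3, ev4 g d x1 x2 x3 = 0 <-> generic_offset f d x1 x2 x3) ->
  prime_elt p -> g = p * m -> ~ divides p m ->
  exists2 r, ~ divides p r & forall d x1 x2 x3,
    ev4 p d x1 x2 x3 = 0 -> ev4 r d x1 x2 x3 != 0 ->
    exists y1 y2 y3 u, offset_system f d x1 x2 x3 y1 y2 y3 u.
Proof.
move=> gV pP eg pNm; have t4 := affine_space_theory K 4.
have [phi [qf rf phiP]] := offset_projection_constructible f.
have [r [b [pNr rP]]] := generic_truth_value t4 env4_regular pP qf rf.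
exists r => // d x1 x2 x3 px rx; apply/phiP.
rewrite (rP (tt, x3, x2, x1, d) px rx).
(* Suppose [b] is false. At a projected point [p] or [m] vanishes, and where [p] does, so must [r].
   Thus [r * m] vanishes on the projection, on its closure, and in particular on [p = 0]. *)
case: b rP => // rP; have [_ _ /(_ r m) pM] := pP; case: pM => //.
apply: (cr_nullstellensatz t4 pP).
move=> [[[[[] a3] a2] a1] e] pa.
have /gV : ev4 g e a1 a2 a3 = 0 by rewrite eg ev4_eval rmorphM [X in X * _]pa mul0r.
move/(_ (r * m)); apply=> e' b1 b2 b3 W.
have : ev4 g e' b1 b2 b3 = 0 by apply/gV => q; apply.
rewrite !ev4_eval eg !rmorphM => /eqP; rewrite mulf_eq0 => /orP[]/eqP.
  move=> pb; have [rb|rb] := eqVneq (ev4 r e' b1 b2 b3) 0.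
    by rewrite [X in X * _]rb mul0r.
  by move/phiP: W; rewrite (rP (tt, b3, b2, b1, e') pb rb).
by move=> ->; rewrite mulr0.
Qed.

Lemma specialized_prime_factor f p r :
  prime_elt p -> ~ divides p r ->
  (forall d x1 x2 x3,
    ev4 p d x1 x2 x3 = 0 -> ev4 r d x1 x2 x3 != 0 ->
    exists y1 y2 y3 u, offset_system f d x1 x2 x3 y1 y2 y3 u) ->
  exists Delta : seq K, forall d, d \notin Delta ->
    forall x1 x2 x3, ev4 p d x1 x2 x3 = 0 -> offset_at f d x1 x2 x3.
Proof.
move=> pP pNr rP; have t3 := affine_space_theory K 3.
have [D DP] := cr_generic_coprime t3 (prime_no_common_factor pP pNr).
exists D => d /DP cpr x1 x2 x3 px q qP.
have {}qP b1 b2 b3 : ev3 (spec4 p d) b1 b2 b3 = 0 ->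
    ev3 (spec4 r d) b1 b2 b3 != 0 -> ev3 q b1 b2 b3 = 0.
  by move=> pb rb; apply: qP; apply: rP.
have cP s : divides s (spec4 p d) -> divides s (spec4 r d) ->
    s \is a GRing.unit.
  by move=> sp sr; apply: cpr => a; rewrite !inE => /orP[]/eqP->.
(* If [p] specializes to 0, then [spec4 r d] is a common factor, hence a unit without zeros, and
   every point of the fibre is projected. *)
have [p0|p0] := eqVneq (spec4 p d) 0.
  apply: qP => //; rewrite ev3_eval -unitfE; apply: rmorph_unit.
  by apply: cP (dividesxx _); rewrite p0; apply: divides0.
have [u [s [uu sP ep]]] := cr_factor t3 p0.
have [w ws wx] : exists2 w, w \in s & ev3 w x1 x2 x3 = 0.
  move/eqP: px; rewrite /ev4 ep ev3_eval rmorphM mulf_eq0.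
  have /negPf-> : @cr_eval K (affine_space K 3) (tt, x3, x2, x1) u != 0.
    by rewrite -unitfE rmorph_unit.
  by rewrite rmorph_prod prodf_seq_eq0 => /hasP[w ws /eqP wx]; exists w.
have wp : divides w (spec4 p d).
  by rewrite ep (big_rem w) //=; apply/divides_mull/divides_mulr/dividesxx.
have [_ wNu /(_ q (spec4 r d)) wM] := sP w ws.
(* [q * spec4 r d] vanishes where [w] does, so [w] divides one of the two. Dividing [spec4 r d]
   would make [w] a common factor, so [w] divides [q], and [q] vanishes at the given point. *)
case: wM.
- apply: (cr_nullstellensatz t3 (sP w ws)) => -[[[[] b3] b2] b1] wb.
  rewrite rmorphM; have [rb|rb] := eqVneq (ev3 (spec4 r d) b1 b2 b3) 0.
    by rewrite [X in _ * X]rb mulr0.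
  have qb : ev3 q b1 b2 b3 = 0; last by rewrite [X in X * _]qb mul0r.
  by apply: qP => //; case: wp => c ->; rewrite ev3_eval rmorphM [X in _ * X]wb mulr0.
- by case=> c ->; rewrite ev3_eval rmorphM [X in _ * X]wx mulr0.
- by move/(cP w wp) => wu; rewrite wu in wNu.
Qed.

Lemma finite_exceptions (T : eqType) (s : seq T) (P : T -> K -> Prop) :
  (forall t, t \in s -> exists D : seq K, forall d, d \notin D -> P t d) ->
  exists D : seq K, forall d, d \notin D -> forall t, t \in s -> P t d.
Proof.
elim: s => [|t s IHs] sP; first by exists [::].
have [|D1 D1P] := IHs; first by move=> x xs; apply: sP; rewrite inE xs orbT.
have [D2 D2P] := sP t (mem_head _ _).
exists (D1 ++ D2) => d; rewrite mem_cat negb_or => /andP[/D1P d1 /D2P d2] x.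
by rewrite inE => /predU1P[->|/d1].
Qed.

End Offset.

Theorem mainTheorem8 (K : closedFieldType) (charK0 : [pchar K] =i pred0)
  (f : poly3 K) (f_irr : irreducible_elt (f : {poly {poly {poly K}}}))
  (h_not_zero_on_Sigma :
     exists y1 y2 y3, ev3 f y1 y2 y3 = 0 /\ h_imp f y1 y2 y3 != 0)
  (g : poly4 K) (g_def : generic_offset_poly f g) :
  exists Delta2 : seq K,
    forall d0 : K, d0 \notin Delta2 -> d0 != 0 ->
      forall x1 x2 x3 : K,
        ev3 (spec4 g d0) x1 x2 x3 = 0 <-> offset_at f d0 x1 x2 x3.
Proof.
case: g_def => [[g0 g_sqf] gV].
have [u [s [uu sP eg]]] := cr_factor (affine_space_theory K 4) g0.
have [|D DP] := @finite_exceptions K _ s (fun p d => forall x1 x2 x3,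
    ev4 (p : poly4 K) d x1 x2 x3 = 0 -> offset_at f d x1 x2 x3).
  move=> p ps; have pP := sP p ps.
  pose m := u * \prod_(q <- rem p s) q.
  have egm : g = p * m by rewrite eg (big_rem p) //= mulrCA.
  (* A second factor [p] in [m] would make [p * p] divide the squarefree [g]. *)
  have pNm : ~ divides p m.
    case=> c em; case: pP => _ /negP[]; apply: (g_sqf p c).
    by rewrite egm em mulrCA mulrC.
  have [r pNr rP] := prime_factor_generically_projected gV pP egm pNm.
  exact: specialized_prime_factor pP pNr rP.
exists D => d dD _ x1 x2 x3; split=> [gx|].
  move: gx; rewrite -/(ev4 g d x1 x2 x3) ev4_eval eg rmorphM => /eqP.
  rewrite mulf_eq0.
  have /negPf-> :
      @cr_eval K (affine_space K 4) (tt, x3, x2, x1, d) u != 0.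
    by rewrite -unitfE rmorph_unit.
  by rewrite rmorph_prod prodf_seq_eq0 => /hasP[p ps /eqP px]; apply: DP px.
(* Conversely, [spec4 g d] is itself a polynomial vanishing on the projection over [d], hence on its
   closure. *)
apply=> b1 b2 b3 W; rewrite -/(ev4 g d b1 b2 b3).
by apply/gV => q; apply.
Qed.
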